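(* Let $\alpha>1$ be an irrational number and $k\ge 2$ an integer. Let $f(x)$ be a polynomial with positive integer coefficients. Let $A$ be an infinite sequence (set) of positive integers with $\overline{d}(A)>\frac{1}{k}-\frac{1}{k\alpha}$. Then $$\Big|\big\{f(a_1)+\cdots+f(a_k): a_i\in A,\ 1\le i\le k\big\}\cap \big\{\lfloor n\alpha\rfloor: n\in \mathbb{N}\big\}\Big|=\infty.$$
   Context: For a set $A$ of positive integers, $\overline{d}(A)=\limsup_{N\to\infty}\frac{|A\cap\{1,\dots,N\}|}{N}$ denotes its upper asymptotic density. $\lfloor x\rfloor$ denotes the integer part of $x$, and $\mathbb{N}$ the set of natural numbers. The elements $a_1,\dots,a_k$ need not be distinct.
   Formalization: The polynomial f is assumed nonconstant; for a constant f = c the set of sums is the single value kc, so the claimed infinitude fails. *)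

(* Defs.v *)
From HB Require Import structures.
From mathcomp Require Import all_boot all_order all_algebra.
From mathcomp Require Import finmap.
From mathcomp Require Import all_classical all_reals all_analysis.

Set Implicit Arguments.
Unset Strict Implicit.
Unset Printing Implicit Defensive.

Import Order.TTheory GRing.Theory Num.Theory.

Local Open Scope classical_set_scope.
Local Open Scope ring_scope.

(* The set intersected with A is finite, so fset_set does not fall back to its
   default value; the term N = 0 is 0 / 0 = 0 and does not affect the limsup. *)
Definition upper_density (R : realType) (A : set nat) : \bar R :=
  limn_esup (fun N : nat =>
    ((#|` fset_set (A `&` [set m : nat | (1 <= m <= N)%N])|%fset)%:R
       / N%:R : R)%:E).

(* Values are in int, the codomain of Num.floor. Taking n = 0 as a natural
   number only adds the element 0. *)
Definition beatty_set (R : realType) (alpha : R) : set int :=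
  [set Num.floor (n%:R * alpha) | n in [set: nat]].

Definition poly_sums (f : {poly int}) (k : nat) (A : set nat) : set int :=
  [set s | exists2 a : 'I_k -> nat, (forall i, A (a i))
                                  & s = \sum_(i < k) f.[(a i)%:Z]].

(* Main.v *)
Require Import Defs.
From HB Require Import structures.
From mathcomp Require Import all_boot all_order all_algebra.
From mathcomp Require Import finmap.
From mathcomp Require Import all_classical all_reals all_analysis.
From mathcomp Require Import zify ring lra.

Set Implicit Arguments.
Unset Strict Implicit.
Unset Printing Implicit Defensive.

Import Order.TTheory GRing.Theory Num.Theory.
Import numFieldNormedType.Exports.

Local Open Scope classical_set_scope.
Local Open Scope ring_scope.

(* Put b = 1 / alpha. An integer s >= 0 is a Beatty number as soon as the
   fractional part of b s exceeds 1 - b. If only finitely many sums were Beatty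
   numbers, then after dropping finitely many elements of A every sum
   b (f a_1 + ... + f a_k) would lie mod 1 in an arc of length 1 - b. Cut the
   circle into p arcs, p prime: since b f(n) is equidistributed mod 1, the arcs
   met by b f(A) number at least about d(A) p, so by Cauchy-Davenport the sums
   meet at least about min(p, k d(A) p) > (1 - b) p of them, a contradiction for
   large p.
   All limiting arguments go through a shift-invariant mean L on bounded
   sequences, a limit of Cesaro means along an ultrafilter chosen so that
   L(1_A) > (1 - b) / k. Equidistribution of b f(n) with respect to L is Weyl's
   theorem, and van der Corput's inequality is error-free for L. *)

(** * Sumsets in prime fields *)

Definition sumset (p : nat) (A B : {set 'F_p}) : {set 'F_p} :=
  ([set a + b | a in A, b in B])%SET.

Lemma sumset_card_ge (p : nat) (A B : {set 'F_p}) (b : 'F_p) :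
  b \in B -> (#|A| <= #|sumset A B|)%N.
Proof.
move=> bB; rewrite -(card_imset (mem A) (addIr b)).
by apply/subset_leq_card/fintype.subsetP => _ /imsetP[a aA ->]; apply: imset2_f.
Qed.

(** Every x is [a] plus a multiple of [d], the multiplier being (x - a) / d read as a natural
    number. *)
Lemma Fp_translation_closed (p : nat) (A : {set 'F_p}) (a d : 'F_p) :
    d != 0 -> a \in A -> (forall x, x \in A -> x + d \in A) ->
  A = [set: 'F_p]%SET.
Proof.
move=> d0 aA Ad; apply/setP => x; rewrite finset.in_setT.
have An n : a + d *+ n \in A.
  by elim: n => [|n IH]; rewrite ?mulr0n ?addr0// mulrSr addrA Ad.
have := An (nat_of_ord ((x - a) / d)).
by rewrite -mulr_natr natr_Zp mulrC divfK// subrKC.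
Qed.

(* The e-transform: (A, B) is replaced by (A :|: (B + e), B :&: (A - e)), which
   keeps #|A| + #|B| and shrinks the sumset; it fails to shrink B for every
   admissible e only if A is invariant under translation by B - B. *)
Lemma cauchy_davenport (p : nat) (A B : {set 'F_p}) (a b : 'F_p) :
    prime p -> a \in A -> b \in B ->
  (minn p (#|A| + #|B|.-1) <= #|sumset A B|)%N.
Proof.
move=> p_pr; have [n] := ubnP #|B|.
elim: n => // n IH in A B a b *; rewrite ltnS => Bn aA bB.
case: (boolP [forall x in A, forall y in B, forall z in B, z + (x - y) \in A]).
  move=> /'forall_in_'forall_in_forall_inP AB.
  have [B1|] := boolP (B == [set b])%SET.
    rewrite geq_min; apply/orP; right.
    by rewrite {1}(eqP B1) cards1 addn0 (sumset_card_ge _ bB).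
  rewrite finset.eqEsubset finset.sub1set bB andbT.
  move=> /fintype.subsetPn[c cB]; rewrite inE => cb.
  have AT : A = [set: 'F_p]%SET.
    apply: (@Fp_translation_closed _ _ a (c - b)) => //.
      by rewrite subr_eq0.
    by move=> x xA; rewrite addrCA AB.
  rewrite geq_min (leq_trans _ (sumset_card_ge A bB))//.
  by rewrite AT cardsT card_Fp.
rewrite negb_forall_in => /exists_inP[x xA]; rewrite negb_forall_in.
move=> /exists_inP[y yB]; rewrite negb_forall_in => /exists_inP[z zB zNA].
set e := x - y in zNA.
(* [B'] is [B] cut with A - e, and [E] is the part of B + e outside [A], so [A :|: E] is the union
   of A and B + e, and [A] gains as many elements as [B] loses. *)
pose B' := ([set u in B | u + e \in A])%SET.
pose E := ([set u + e | u in B :\: B'])%SET.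
have B'B : B' \subset B by apply/fintype.subsetP => u; rewrite inE => /andP[].
have yB' : y \in B' by rewrite inE yB /e addrC subrK.
have AE : [disjoint A & E]%B.
  rewrite disjoint_sym disjoint_subset; apply/fintype.subsetP => v /imsetP[u].
  by move=> + ->; rewrite !inE => /andP[+ uB]; rewrite uB.
have cardE : #|E| = (#|B| - #|B'|)%N.
  by rewrite (card_imset _ (addIr e)) cardsD (finset.setIidPr B'B).
have cAE : (#|A :|: E| = #|A| + (#|B| - #|B'|))%N.
  by rewrite cardsU (finset.disjoint_setI0 AE) cards0 subn0 cardE.
have ltB : (#|B'| < #|B|)%N.
  apply/proper_card/fintype.properP; split=> //; exists z => //.
  by rewrite inE zB.
have B'0 : (0 < #|B'|)%N by apply/card_gt0P; exists y.
apply: leq_trans (subset_leq_card (_ : sumset (A :|: E) B' \subset _)).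
  apply: leq_trans (IH _ _ x y (leq_trans ltB Bn) _ yB'); last first.
    by rewrite inE xA.
  by rewrite cAE; move: #|A| #|B| #|B'| ltB B'0; clear; lia.
apply/fintype.subsetP => _ /imset2P[u v + /[!inE] /andP[vB vA] ->].
move=> /finset.setUP[uA|/imsetP[w /finset.setDP[wB _] ->]].
  exact: imset2_f.
(* Here the sum is (w + e) + v, regrouped as (v + e) + w with v + e in [A] and w in [B]. *)
by rewrite -addrA addrC (addrC e); apply: imset2_f.
Qed.

(** * Invariant means *)

Definition seq_bounded (R : realType) (u : nat -> R) :=
  exists C, forall n, `|u n| <= C.

(** The terms are u 1, ..., u N, the same range as the one counted by [upper_density]. *)
Definition cesaro_mean (R : realType) (u : nat -> R) (N : nat) : R :=
  (\sum_(i < N) u i.+1) / N%:R.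

Record invariant_mean (R : realType) (L : (nat -> R) -> R) : Prop :=
  InvariantMean {
    mean_add : forall u v, seq_bounded u -> seq_bounded v ->
      L (fun n => u n + v n) = L u + L v ;
    mean_scale : forall c u, seq_bounded u -> L (fun n => c * u n) = c * L u ;
    mean_le : forall u v, seq_bounded u -> seq_bounded v ->
      (forall n, u n <= v n) -> L u <= L v ;
    mean_cst : forall c, L (fun _ => c) = c ;
    mean_shift1 : forall u, seq_bounded u -> L (fun n => u n.+1) = L u }.

Lemma seq_bounded_cst (R : realType) (c : R) : seq_bounded (fun _ => c).
Proof. by exists `|c|. Qed.

Lemma seq_bounded_add (R : realType) (u v : nat -> R) :
  seq_bounded u -> seq_bounded v -> seq_bounded (fun n => u n + v n).
Proof.
move=> [C uC] [D vD]; exists (C + D) => n.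
by rewrite (le_trans (ler_normD _ _))// lerD.
Qed.

Lemma seq_bounded_mul (R : realType) (u v : nat -> R) :
  seq_bounded u -> seq_bounded v -> seq_bounded (fun n => u n * v n).
Proof.
move=> [C uC] [D vD]; exists (C * D) => n.
by rewrite normrM ler_pM.
Qed.

Lemma seq_bounded_scale (R : realType) (c : R) (u : nat -> R) :
  seq_bounded u -> seq_bounded (fun n => c * u n).
Proof. by move=> ub; apply: seq_bounded_mul => //; exact: seq_bounded_cst. Qed.

Lemma seq_bounded_comp (R : realType) (u : nat -> R) (s : nat -> nat) :
  seq_bounded u -> seq_bounded (fun n => u (s n)).
Proof. by move=> [C uC]; exists C. Qed.

Lemma seq_bounded_sum (R : realType) (I : Type) (r : seq I)
    (u : I -> nat -> R) :
  (forall i, seq_bounded (u i)) -> seq_bounded (fun n => \sum_(i <- r) u i n).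
Proof.
move=> ub; elim: r => [|i r IH].
  by under eq_fun do rewrite big_nil; exact: seq_bounded_cst.
by under eq_fun do rewrite big_cons; exact: seq_bounded_add.
Qed.

Lemma seq_bounded_bool (R : realType) (P : nat -> bool) :
  seq_bounded (fun n => (P n)%:R : R).
Proof. by exists 1 => n; case: (P n); rewrite ?normr0 ?normr1. Qed.

(** Compactness of [-C, C] gives a cluster point, and an ultrafilter converges to each of its
    cluster points. *)
Lemma ultra_bounded_cvg (R : realType) (T : Type) (U : set_system T)
    (g : T -> R) (C : R) :
  UltraFilter U -> (forall t, `|g t| <= C) -> cvg (g @ U).
Proof.
move=> UU gC.
have [|p [_ pcl]] := @segment_compact R (- C) C (g @ U) _.
  by apply: (@filterS _ U _ setT); [move=> t _; rewrite /= in_itv/= -ler_norml|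
     exact: filterT].
apply/cvg_ex; exists p => B pB.
have [//|UnB] := in_ultra_setVsetC (g @^-1` B) UU.
have [t []] := pcl (~` B) B UnB pB.
by [].
Qed.

Lemma exists_invariant_mean (R : realType) (D : set nat) :
    (forall n, exists2 N, (n <= N)%N & D N) ->
  exists2 L : (nat -> R) -> R, invariant_mean L &
    forall u d, seq_bounded u ->
      (forall N, D N -> d <= cesaro_mean u N) -> d <= L u.
Proof.
(* An ultrafilter finer than [F] contains [D], which carries the lower bound to the limit, and all
   tails, which give shift invariance. *)
move=> Dinf; pose F := within D \oo.
have FF : ProperFilter F.
  split; last exact: within_filter.
  by move=> [n _ nD]; have [N nN DN] := Dinf n; exact: nD DN.
have [U [UU FU]] := ultraFilterLemma FF.
have ooU : U --> \oo by move=> A oA; apply: FU; apply: filterS oA => ? ? ?.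
have cesC (u : nat -> R) C :
    (forall n, `|u n| <= C) -> forall N, `|cesaro_mean u N| <= C.
  move=> uC N; have C0 : 0 <= C by exact: le_trans (uC 0).
  rewrite /cesaro_mean normrM normfV (ger0_norm (ler0n _ _)).
  case: N => [|N]; first by rewrite invr0 mulr0.
  rewrite ler_pdivrMr ?ltr0n// (le_trans (ler_norm_sum _ _ _))//.
  apply: le_trans (ler_sum _ _ : _ <= \sum_(i < N.+1) C) _ => //.
  by rewrite sumr_const card_ord mulr_natr.
have cesU (u : nat -> R) : seq_bounded u -> cvg (cesaro_mean u @ U).
  by move=> [C uC]; exact: ultra_bounded_cvg (cesC _ _ uC).
exists (fun u => lim (cesaro_mean u @ U)); last first.
  move=> u d ub ud; apply: limr_ge; first exact: cesU.
  by apply: FU; exists 0%N => // N _; exact: ud.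
split.
- move=> u v ub vb; rewrite -limD; [|exact: cesU|exact: cesU].
  congr (lim (_ @ U)).
  by apply/funext => N; rewrite /cesaro_mean big_split mulrDl.
- move=> c u ub; apply: cvg_lim => //.
  rewrite (_ : cesaro_mean _ = fun N => c * cesaro_mean u N).
    by apply: cvgMl_tmp; exact: cesU.
  by apply/funext => N; rewrite /cesaro_mean -mulr_sumr mulrA.
- move=> u v ub vb uv; apply: ler_lim; [exact: cesU|exact: cesU|].
  by apply: nearW => N; rewrite /cesaro_mean ler_wpM2r ?invr_ge0// ler_sum.
(* The Cesaro mean of a constant equals it only from N = 1 on: at N = 0 division by zero gives 0. *)
- move=> c; apply: cvg_lim => //; apply: cvg_trans (@cvg_cst _ c _ U _).
  apply: near_eq_cvg; apply: ooU; exists 1%N => // N /= N1.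
  rewrite /cesaro_mean sumr_const card_ord -[c *+ N]mulr_natr mulfK// pnatr_eq0.
  by rewrite -lt0n.
move=> u ub; have [C uC] := ub.
apply/eqP; rewrite -subr_eq0; apply/eqP.
have ub1 := seq_bounded_comp succn ub.
rewrite -limB; [|exact: cesU|exact: cesU]; apply: cvg_lim => //.
apply: cvg_trans; first exact: (cvg_app _ ooU).
apply/cvgr0Pnorm_le => e e0; near=> N.
have N0 : (0 < N)%N by near: N; exact: nbhs_infty_gt.
rewrite /= /cesaro_mean !fctE -mulrBl -sumrB.
(* The difference of the two Cesaro sums telescopes, so the means differ by at most 2C / N. *)
rewrite (_ : \sum_(_ < _) _ = u N.+1 - u 1%N); last first.
  rewrite -(big_mkord xpredT (fun i => u i.+2 - u i.+1)).
  exact: (telescope_sumr (fun i => u i.+1)).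
rewrite normrM normfV (ger0_norm (ler0n _ _)) ler_pdivrMr ?ltr0n//.
rewrite (le_trans (ler_normB _ _))// (le_trans (lerD (uC _) (uC _)))//.
rewrite mulrC -ler_pdivrMr//; near: N; exact: nbhs_infty_ger.
Unshelve. all: by end_near. Qed.

(** * Weyl's theorem for integer polynomials *)

Lemma mean_shift (R : realType) (L : (nat -> R) -> R) (u : nat -> R) (h : nat) :
  invariant_mean L -> seq_bounded u -> L (fun n => u (n + h)%N) = L u.
Proof.
move=> mL ub; elim: h => [|h IH].
  by congr L; apply/funext => n; rewrite addn0.
rewrite -IH -[RHS](mean_shift1 mL); last exact: seq_bounded_comp.
by congr L; apply/funext => n; rewrite addnS.
Qed.

Lemma mean_sum (R : realType) (L : (nat -> R) -> R) (I : Type) (r : seq I)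
    (u : I -> nat -> R) :
    invariant_mean L -> (forall i, seq_bounded (u i)) ->
  L (fun n => \sum_(i <- r) u i n) = \sum_(i <- r) L (u i).
Proof.
move=> mL ub; elim: r => [|i r IH].
  by under eq_fun do rewrite big_nil; rewrite big_nil (mean_cst mL).
under eq_fun do rewrite big_cons.
by rewrite big_cons (mean_add mL) ?IH//; exact: seq_bounded_sum.
Qed.

(** Positivity applied to (u - c)^2 with c = L u: the mean of a square dominates that of the affine
    function 2cu - c^2. *)
Lemma mean_sqr_ge (R : realType) (L : (nat -> R) -> R) (u : nat -> R) :
  invariant_mean L -> seq_bounded u -> L u ^+ 2 <= L (fun n => u n ^+ 2).
Proof.
move=> mL ub; set c := L u.
have -> : c ^+ 2 = L (fun n => (c *+ 2) * u n + (- c ^+ 2)).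
  rewrite (mean_add mL) ?(mean_cst mL) ?(mean_scale mL)// -/c; first by ring.
  - exact: seq_bounded_scale.
  - exact: seq_bounded_cst.
apply: (mean_le mL).
- apply: seq_bounded_add; [exact: seq_bounded_scale|exact: seq_bounded_cst].
- exact: seq_bounded_mul.
- move=> n; rewrite -subr_ge0.
  suff -> : u n ^+ 2 - (c *+ 2 * u n + - c ^+ 2) = (u n - c) ^+ 2.
    exact: sqr_ge0.
  by ring.
Qed.

Lemma seq_bounded_cos (R : realType) (x : nat -> R) :
  seq_bounded (fun n => cos (x n)).
Proof. by exists 1 => n; exact: cos_max. Qed.

Lemma seq_bounded_sin (R : realType) (x : nat -> R) :
  seq_bounded (fun n => sin (x n)).
Proof. by exists 1 => n; rewrite ler_norml sin_geN1 sin_le1. Qed.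

Lemma sum_sqr_eq0 (R : realType) (a b : R) :
  a ^+ 2 + b ^+ 2 = 0 -> a = 0 /\ b = 0.
Proof.
move/eqP; rewrite paddr_eq0 ?sqr_ge0// !sqrf_eq0 => /andP[/eqP -> /eqP ->].
by [].
Qed.

(* Orthogonality of the shifts of exp(i x) for the inner product given by L;
   Bessel's inequality then bounds |L exp(i x)|^2 by 1/H for every H. *)
Lemma van_der_corput (R : realType) (L : (nat -> R) -> R) (x : nat -> R) :
    invariant_mean L ->
    (forall h, (0 < h)%N -> L (fun n => cos (x (n + h)%N - x n)) = 0) ->
  L (fun n => cos (x n)) = 0 /\ L (fun n => sin (x n)) = 0.
Proof.
move=> mL xL; apply: sum_sqr_eq0.
set c := L _; set s := L _.
pose U H n := \sum_(h < H) cos (x (n + h)%N).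
pose V H n := \sum_(h < H) sin (x (n + h)%N).
have Ub H : seq_bounded (U H).
  by apply: seq_bounded_sum => h; exact: seq_bounded_cos.
have Vb H : seq_bounded (V H).
  by apply: seq_bounded_sum => h; exact: seq_bounded_sin.
have LU H : L (U H) = H%:R * c.
  rewrite /U mean_sum//; last by move=> i; exact: seq_bounded_cos.
  under eq_bigr => h _ do
    rewrite (mean_shift _ mL (seq_bounded_cos x)).
  by rewrite sumr_const card_ord mulr_natl.
have LV H : L (V H) = H%:R * s.
  rewrite /V mean_sum//; last by move=> i; exact: seq_bounded_sin.
  under eq_bigr => h _ do
    rewrite (mean_shift _ mL (seq_bounded_sin x)).
  by rewrite sumr_const card_ord mulr_natl.
(* The shift by [H] adds 1 and the cross term 2 [W]; each summand of [W] is a shifted correlation of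
   lag H - h > 0, hence of mean 0. *)
have UV H : L (fun n => U H n ^+ 2 + V H n ^+ 2) = H%:R.
  elim: H => [|H IH].
    rewrite -[RHS](mean_cst mL); congr L; apply/funext => n.
    by rewrite /U /V !big_ord0 expr0n addr0.
  pose W n := \sum_(h < H) cos (x (n + H)%N - x (n + h)%N).
  have Wb : seq_bounded W.
    by apply: seq_bounded_sum => h; exact: seq_bounded_cos.
  have UVb : seq_bounded (fun n => U H n ^+ 2 + V H n ^+ 2).
    by apply: seq_bounded_add; exact: seq_bounded_mul.
  have LW : L W = 0.
    rewrite /W mean_sum//; last by move=> i; exact: seq_bounded_cos.
    apply: big1 => h _; rewrite -(xL (H - h)%N) ?subn_gt0//.
    rewrite -[RHS](mean_shift h mL); last exact: seq_bounded_cos.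
    congr L; apply/funext => n.
    by rewrite -addnA subnKC// ltnW.
  rewrite (_ : (fun n => _) = fun n =>
      (U H n ^+ 2 + V H n ^+ 2) + (1 + 2 * W n)).
    have W2b : seq_bounded (fun n => 2 * W n) by exact: seq_bounded_scale.
    rewrite (mean_add mL) ?IH ?(mean_add mL (seq_bounded_cst 1))//.
      by rewrite (mean_cst mL) (mean_scale mL)// LW mulr0 addr0 natr1.
    exact: seq_bounded_add (seq_bounded_cst 1) _.
  apply/funext => n; rewrite /U /V !big_ord_recr/= -/(U H n) -/(V H n).
  have -> : W n = cos (x (n + H)%N) * U H n + sin (x (n + H)%N) * V H n.
    by rewrite !mulr_sumr -big_split; apply: eq_bigr => h _; rewrite cosB.
  by ring: (cos2sin2 (x (n + H)%N)).
have csH (H : nat) : (0 < H)%N -> (c ^+ 2 + s ^+ 2) * H%:R <= 1.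
  move=> H0; rewrite -(ler_pM2r (_ : 0 < H%:R :> R)) ?ltr0n// mul1r.
  rewrite -[leRHS]UV (mean_add mL); [|exact: seq_bounded_mul..].
  apply: le_trans (lerD (mean_sqr_ge mL (Ub H)) (mean_sqr_ge mL (Vb H))).
  by rewrite LU LV le_eqVlt; apply/orP; left; apply/eqP; ring.
apply/eqP; rewrite eq_le addr_ge0 ?sqr_ge0// andbT leNgt; apply/negP => e0.
set e := c ^+ 2 + s ^+ 2 in csH e0.
have := csH (Num.truncn e^-1).+1 isT; rewrite leNgt => /negP; apply.
by rewrite mulrC -ltr_pdivrMr// div1r; exact: truncnS_gt.
Qed.

(** Shift invariance says that z = L exp(i x) satisfies z = exp(i t) z. The real part of conj(z) (z
    - exp(i t) z) is |z|^2 (1 - cos t), which therefore vanishes. *)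
Lemma mean_rotation (R : realType) (L : (nat -> R) -> R) (x : nat -> R)
    (t : R) :
    invariant_mean L -> (forall n, x n.+1 = x n + t) -> cos t != 1 ->
  L (fun n => cos (x n)) = 0 /\ L (fun n => sin (x n)) = 0.
Proof.
move=> mL xt t1; apply: sum_sqr_eq0.
have := mean_shift1 mL (seq_bounded_cos x).
under eq_fun do rewrite xt cosD -mulNr mulrC.
rewrite (mean_add mL); last 2 first.
- by apply: seq_bounded_scale; exact: seq_bounded_cos.
- apply: seq_bounded_mul; last exact: seq_bounded_cst.
  by exists 1 => n; rewrite normrN ler_norml sin_geN1 sin_le1.
under [X in _ + L X]eq_fun do rewrite mulNr -mulrN mulrC.
rewrite !(mean_scale mL); [|exact: seq_bounded_sin|exact: seq_bounded_cos].
have := mean_shift1 mL (seq_bounded_sin x).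
under eq_fun do rewrite xt sinD mulrC.
rewrite (mean_add mL); last 2 first.
- by apply: seq_bounded_scale; exact: seq_bounded_sin.
- by apply: seq_bounded_mul; [exact: seq_bounded_cos|exact: seq_bounded_cst].
under [X in _ + L X]eq_fun do rewrite mulrC.
rewrite !(mean_scale mL); [|exact: seq_bounded_cos|exact: seq_bounded_sin].
set s := L _; set c := L _ => sE cE.
have : (c ^+ 2 + s ^+ 2) * (1 - cos t) = 0.
  rewrite (_ : _ * _ = c * (c - (cos t * c + - sin t * s)) +
                       s * (s - (cos t * s + sin t * c))); last by ring.
  by rewrite cE sE !subrr !mulr0 addr0.
by move/eqP; rewrite mulf_eq0 subr_eq0 [1 == _]eq_sym (negPf t1) orbF => /eqP.
Qed.

Lemma cos_2pi_int (R : realType) (t : R) (m : int) :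
  cos (2 * pi * (t + m%:~R)) = cos (2 * pi * t).
Proof.
have nat_case (n : nat) (y : R) : cos (2 * pi * (y + n%:R)) = cos (2 * pi * y).
  rewrite mulrDr (_ : 2 * pi * n%:R = (pi *+ 2) *+ n).
    exact: (periodicn (@cosD2pi R)).
  by rewrite -(mulr_natr (pi *+ 2)) -(mulr_natl pi).
case: m => n; first exact: nat_case.
by rewrite NegzE -[LHS](nat_case n.+1) mulrNz -pmulrn subrK.
Qed.

Definition fracpart (R : realType) (x : R) : R := x - (Num.floor x)%:~R.

Lemma fracpart_itv (R : realType) (x : R) : 0 <= fracpart x < 1.
Proof. by rewrite subr_ge0 floor_le/= ltrBlDl -intrD1 floorD1_gt. Qed.

Lemma cos_2pi_fracpart (R : realType) (x : R) :
  cos (2 * pi * fracpart x) = cos (2 * pi * x).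
Proof. by rewrite -(cos_2pi_int _ (Num.floor x)) subrK. Qed.

(** By the half-angle formula sin (pi y) = 0 for the fractional part y, while sine is positive on
    (0, pi). *)
Lemma cos_2pi_eq1 (R : realType) (t : R) :
  cos (2 * pi * t) = 1 -> t = (Num.floor t)%:~R.
Proof.
have y01 := fracpart_itv t; rewrite -(cos_2pi_fracpart t).
set y := fracpart t in y01 *.
move=> cy; suff : y = 0 by move/eqP; rewrite subr_eq0 => /eqP.
have : sin (pi * y) ^+ 2 = 0.
  move: cy; rewrite (_ : 2 * pi * y = (pi * y) *+ 2); last by ring.
  by rewrite cos_mulr2n cos2sin2; lra.
move/eqP; rewrite sqrf_eq0 => /eqP sy.
apply/eqP; rewrite eq_le (andP y01).1 andbT leNgt; apply/negP => ygt0.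
have : 0 < sin (pi * y).
  apply: sin_gt0_pi; rewrite mulr_gt0 ?pi_gt0//= gtr_pMr ?pi_gt0//.
  by case/andP: y01.
by rewrite sy ltxx.
Qed.

(** Taylor's formula with the divided derivatives [nderivn] stays over [int]. One degree below [g]
    the coefficient is [h] times the degree times the leading coefficient, hence nonzero. *)
Lemma poly_difference (g : {poly int}) (h : nat) :
    (0 < h)%N -> (1 < size g)%N ->
  exists2 D : {poly int}, size D = (size g).-1 &
    forall n : nat, D.[n%:Z] = g.[(n + h)%N%:Z] - g.[n%:Z].
Proof.
move=> h0 g1.
pose D := \sum_(i < (size g).-1) (h%:Z ^+ i.+1) *: g^`N(i.+1).
exists D; last first.
  move=> n; rewrite /D PoszD nderiv_taylor; last exact: mulrC.
  case: (size g) g1 => // s _.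
  rewrite big_ord_recl expr0 mulr1 nderivn0 addrC addKr.
  by rewrite horner_sum; apply: eq_bigr => i _; rewrite hornerZ mulrC.
have coefD j : D`_j =
    \sum_(i < (size g).-1) h%:Z ^+ i.+1 * (g`_(i.+1 + j) *+ 'C(i.+1 + j, i.+1)).
  by rewrite /D coef_sum; apply: eq_bigr => i _; rewrite coefZ coef_nderivn.
apply/eqP; rewrite eqn_leq; apply/andP; split.
  apply/leq_sizeP => j gj; rewrite coefD big1// => i _.
  rewrite nth_default ?mul0rn ?mulr0// addSn (leq_trans (leqSpred _))// ltnS.
  exact: leq_trans gj (leq_addl _ _).
rewrite leqNgt; apply/negP => sD.
have : D`_(size g).-2 = 0.
  by apply: nth_default; move: (size D) sD; clear -g1; lia.
rewrite coefD; case E : (size g) g1 {sD} => [|[|s]]//= _.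
rewrite big_ord_recl big1 ?addr0/= => [|i _]; last first.
  by rewrite nth_default ?mul0rn ?mulr0// E; rewrite /bump /=; lia.
rewrite expr1 add1n bin1 => /eqP; rewrite mulf_eq0 mulrn_eq0/=.
have -> : g`_s.+1 = lead_coef g by rewrite lead_coefE E.
by rewrite lead_coef_eq0 -size_poly_eq0 E orbF => /eqP; lia.
Qed.

(** Weyl differencing: van der Corput's inequality replaces [g] by its differences, of degree one
    less, down to the linear case, which is an irrational rotation. *)
Lemma weyl_poly (R : realType) (L : (nat -> R) -> R) (b : R)
    (g : {poly int}) :
    invariant_mean L -> irrational b -> (1 < size g)%N ->
  L (fun n => cos (2 * pi * (b * (g.[n%:Z])%:~R))) = 0 /\
  L (fun n => sin (2 * pi * (b * (g.[n%:Z])%:~R))) = 0.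
Proof.
move=> mL bi; have [d] := ubnP (size g).
elim: d => // d IH in g *; rewrite ltnS => gd g1.
have [g2|g2] := leqP (size g) 2.
  have gs : size g = 2 by apply/eqP; rewrite eqn_leq g2.
  have g0 : g`_1 != 0.
    have -> : g`_1 = lead_coef g by rewrite lead_coefE gs.
    by rewrite lead_coef_eq0 -size_poly_eq0 gs.
  apply: (@mean_rotation _ _ _ (2 * pi * (b * (g`_1)%:~R))) => // [n|].
    rewrite -mulrDr -mulrDr -intrD; congr (_ * (_ * _%:~R)).
    rewrite !horner_coef gs !big_ord_recl !big_ord0/= !expr0 !expr1 /bump/=.
    by rewrite intS; ring.
  apply/eqP => /cos_2pi_eq1 bg; apply: bi.
  set m := Num.floor _ in bg.
  have bE : b = m%:~R / (g`_1)%:~R by rewrite -bg mulfK// intr_eq0.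
  by exists (m%:~R / (g`_1)%:~R) => //; rewrite fmorph_div/= !ratr_int.
apply: van_der_corput => // h h0.
have [D sD DE] := poly_difference h0 g1.
have [|//|<- _] := IH D; rewrite ?sD; try lia.
congr L; apply/funext => n.
by rewrite DE -!mulrBr -intrB.
Qed.

(** * Equidistribution in arcs *)

(** Weyl's criterion for equidistribution mod 1, with [L] in place of the limit of averages. *)
Definition weyl_seq (R : realType) (L : (nat -> R) -> R) (x : nat -> R) :=
  forall h : int, h != 0 ->
    L (fun n => cos (2 * pi * (h%:~R * x n))) = 0 /\
    L (fun n => sin (2 * pi * (h%:~R * x n))) = 0.

(** Horner's scheme with cos(h t) cos t = (cos((h + 1) t) + cos((h - 1) t)) / 2. *)
Lemma poly_cos_sum (R : realType) (P : {poly R}) :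
  exists s : seq (R * int), forall y,
    P.[cos (2 * pi * y)] = \sum_(t <- s) t.1 * cos (2 * pi * (t.2%:~R * y)).
Proof.
elim/poly_ind: P => [|P c [s IH]].
  by exists [::] => y; rewrite horner0 big_nil.
exists ((c, 0) :: map (fun t => (t.1 / 2, t.2 + 1)) s
             ++ map (fun t => (t.1 / 2, t.2 - 1)) s) => y.
rewrite hornerMXaddC IH big_cons big_cat !big_map/=.
rewrite mul0r mulr0 cos0 mulr1 [LHS]addrC; congr (_ + _).
rewrite -big_split mulr_suml; apply: eq_bigr => t _ /=.
rewrite intrD intrB.
rewrite (_ : 2 * pi * ((t.2%:~R + 1) * y) =
             2 * pi * (t.2%:~R * y) + 2 * pi * y); last by ring.
rewrite (_ : 2 * pi * ((t.2%:~R - 1) * y) =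
             2 * pi * (t.2%:~R * y) - 2 * pi * y); last by ring.
by rewrite cosD cosB; field.
Qed.

(** Only the frequency 0 survives [L], and its coefficient does not see the translation by c. *)
Lemma mean_poly_cos (R : realType) (L : (nat -> R) -> R) (x : nat -> R)
    (P : {poly R}) :
    invariant_mean L -> weyl_seq L x ->
  exists m, forall c, L (fun n => P.[cos (2 * pi * (x n - c))]) = m.
Proof.
move=> mL xw; have [s Ps] := poly_cos_sum P.
exists (\sum_(t <- s) if t.2 == 0 then t.1 else 0) => c.
under eq_fun do rewrite Ps.
rewrite mean_sum//; last first.
  by move=> t; apply: seq_bounded_scale; exact: seq_bounded_cos.
apply: eq_bigr => -[a h] _ /=; rewrite (mean_scale mL); last first.
  exact: seq_bounded_cos.
have [->|h0] := eqVneq h 0.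
  under eq_fun do rewrite mul0r mulr0 cos0.
  by rewrite (mean_cst mL) mulr1.
have [cx sx] := xw h h0.
under eq_fun do rewrite mulrBr mulrBr cosB mulrC [sin _ * _]mulrC.
rewrite (mean_add mL) ?(mean_scale mL) ?cx ?sx ?mulr0 ?addr0 ?mulr0//.
- exact: seq_bounded_sin.
- exact: seq_bounded_cos.
- by apply: seq_bounded_scale; exact: seq_bounded_cos.
- by apply: seq_bounded_scale; exact: seq_bounded_sin.
Qed.

Lemma bernoulli_ge (R : realDomainType) (x : R) (n : nat) :
  -1 <= x -> 1 + n%:R * x <= (1 + x) ^+ n.
Proof.
move=> x1; elim: n => [|n IH]; first by rewrite mul0r addr0 expr0.
rewrite exprS -natr1; apply: le_trans (ler_wpM2l _ IH); last by lra.
have : 0 <= n%:R * x ^+ 2 by rewrite mulr_ge0// sqr_ge0.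
by rewrite expr2; nra.
Qed.

(** Since (1 - w)^n (1 + w)^n = (1 - w^2)^n <= 1; this makes (1 - w)^n small once n w is large. *)
Lemma bernoulli_le (R : realDomainType) (w : R) (n : nat) :
  0 <= w <= 1 -> (1 - w) ^+ n * (1 + n%:R * w) <= 1.
Proof.
move=> /andP[w0 w1].
apply: le_trans (_ : (1 - w) ^+ n * (1 + w) ^+ n <= _).
  by rewrite ler_wpM2l ?exprn_ge0 ?bernoulli_ge//; lra.
by rewrite -exprMn exprn_ile1//; nra.
Qed.

(* With v in [0, 1] affine in u and equal to 1/2 between b and a, the polynomial
   1 - (1 - v^n)^(2^n) tends to 1 where v > 1/2 and to 0 where v < 1/2. *)
Lemma step_poly (R : realType) (a b e : R) :
    -1 <= b -> b < a -> a <= 1 -> 0 < e ->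
  exists P : {poly R}, forall u, -1 <= u <= 1 ->
    [/\ 0 <= P.[u] <= 1, a <= u -> 1 - e <= P.[u] & u <= b -> P.[u] <= e].
Proof.
move=> b1 ba a1 e0.
(* With v = 1/2 + (u - (a + b) / 2) / 4 below, u >= a gives 2v >= 1 + d and u <= b gives 2v <= 1 -
   d; [n] is large enough for (1 + d)^n >= 1 / e. *)
pose d := (a - b) / 4; have d0 : 0 < d by rewrite /d; lra.
pose n := (Num.truncn (e * d)^-1).+1.
have nP : 1 <= e * (1 + d) ^+ n.
  apply: le_trans (_ : e * (1 + n%:R * d) <= _); last first.
    by rewrite ler_wpM2l ?bernoulli_ge//; lra.
  have : (e * d)^-1 < n%:R by exact: truncnS_gt.
  by rewrite -[_^-1]mul1r ltr_pdivrMr ?(mulr_gt0 e0 d0)// => nd; nra.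
have D0 : 0 < (1 + d) ^+ n by rewrite exprn_gt0//; lra.
have [v vE] : exists v : {poly R},
    forall u, v.[u] = (u + (2 - (a + b) / 2)) / 4.
  exists ((1 / 4) *: ('X + (2 - (a + b) / 2)%:P)) => u.
  by rewrite !hornerE; field.
exists (1 - (1 - v ^+ n) ^+ (2 ^ n)) => u u1; have vu := vE u.
have -> : (1 - (1 - v ^+ n) ^+ (2 ^ n)).[u] = 1 - (1 - v.[u] ^+ n) ^+ (2 ^ n).
  by rewrite !(hornerD, hornerN, horner_exp, hornerC).
set w := v.[u] in vu *.
have w01 : 0 <= w <= 1 by rewrite vu; lra.
have wn : 0 <= w ^+ n <= 1.
  by case/andP: w01 => w0 w1; rewrite exprn_ge0// exprn_ile1.
have W01 : 0 <= (1 - w ^+ n) ^+ (2 ^ n) <= 1.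
  by rewrite exprn_ge0 ?exprn_ile1//; lra.
have E2 : (2 ^ n)%:R * w ^+ n = (2 * w) ^+ n by rewrite natrX exprMn.
split.
- by lra.
- move=> au; have := bernoulli_le (2 ^ n) wn; rewrite E2.
  have : (1 + d) ^+ n <= (2 * w) ^+ n.
    by rewrite lerXn2r ?nnegrE; rewrite ?vu /d; lra.
  move=> DZ WZ; suff : (1 - w ^+ n) ^+ (2 ^ n) <= e by lra.
  rewrite -(ler_pM2r D0) (le_trans _ nP)//.
  have /andP[W0 _] := W01; have := ler_wpM2l W0 DZ; lra.
- move=> ub.
  have : 1 + (2 ^ n)%:R * (- w ^+ n) <= (1 - w ^+ n) ^+ (2 ^ n).
    by apply: bernoulli_ge; lra.
  rewrite mulrN E2 => WZ.
  have ZD : (2 * w) ^+ n * (1 + d) ^+ n <= 1.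
    have wd : 2 * w <= 1 - d by rewrite vu /d; lra.
    by rewrite -exprMn exprn_ile1// ?mulr_ge0//; try lra; nra.
  suff : (2 * w) ^+ n <= e by lra.
  by rewrite -(ler_pM2r D0) (le_trans ZD).
Qed.

Lemma cos_le_cos (R : realType) (s t : R) :
  0 <= s -> s <= t -> t <= 2 * pi - s -> cos t <= cos s.
Proof.
move=> s0 st ts.
have half (y : R) : s <= y -> y <= pi -> cos y <= cos s.
  by move=> sy yp; rewrite leNgt ltr_cos -?leNgt// in_itv/=; lra.
have [tp|tp] := leP t pi; first exact: half.
have -> : cos t = cos (2 * pi - t).
  by rewrite -[LHS]cosN -[LHS](@cosD2pi R) addrC mulr_natl.
by apply: half; lra.
Qed.

(* Index of the arc [i/q, (i+1)/q) of the circle that contains y mod 1. *)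
Definition cell (R : realType) (q : nat) (y : R) : nat :=
  Num.truncn (q%:R * fracpart y).

Lemma cell_itv (R : realType) (q : nat) (y : R) :
  (cell q y)%:R <= q%:R * fracpart y < (cell q y).+1%:R.
Proof.
have /andP[f0 _] := fracpart_itv y.
by rewrite /cell truncn_itv// mulr_ge0.
Qed.

Lemma cell_lt (R : realType) (q : nat) (y : R) : (0 < q)%N -> (cell q y < q)%N.
Proof.
move=> q0; have /andP[f0 f1] := fracpart_itv y.
have /andP[cq _] := cell_itv q y.
rewrite -(ltr_nat R) (le_lt_trans cq)//.
by rewrite gtr_pMr// ltr0n.
Qed.

Lemma cell_eq (R : realType) (q i : nat) (y : R) :
  (cell q y == i) = (i%:R <= q%:R * fracpart y < i.+1%:R).
Proof.
have /andP[f0 _] := fracpart_itv y.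
by rewrite /cell truncn_eq// mulr_ge0.
Qed.

Definition cell_mid (R : realType) (q i : nat) : R := (i%:R + 1 / 2) / q%:R.

Lemma cos_cell (R : realType) (q i : nat) (y : R) :
  cos (2 * pi * (y - cell_mid R q i)) =
  cos (2 * pi * `|fracpart y - cell_mid R q i|).
Proof.
rewrite -[RHS]cos_norm normrM normr_id -normrM cos_norm.
rewrite -[RHS](cos_2pi_int _ (Num.floor y)); congr (cos (_ * _)).
by rewrite /fracpart; ring.
Qed.

Lemma q_cell_mid (R : realType) (q i : nat) (f : R) : (0 < q)%N ->
  q%:R * `|f - cell_mid R q i| = `|q%:R * f - (i%:R + 1 / 2)|.
Proof.
move=> q0; have q1 : 0 < q%:R :> R by rewrite ltr0n.
rewrite -{1}(gtr0_norm q1) -normrM mulrBr /cell_mid.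
by rewrite mulrCA divff ?mulr1// gt_eqF.
Qed.

(** A point of an arc is within 1/(2q) of its midpoint. With the converse bound off the arc, a
    threshold on the cosine detects the arc. *)
Lemma cos_cell_ge (R : realType) (q : nat) (y : R) :
    (0 < q)%N ->
  cos (pi / q%:R) <= cos (2 * pi * (y - cell_mid R q (cell q y))).
Proof.
move=> q0; rewrite cos_cell.
have := cell_itv q y; set i := cell q y => /andP[iq]; rewrite -natr1 => qi.
have q1 : 1 <= q%:R :> R by rewrite ler1n.
have p0 := @pi_gt0 R.
have qp : pi / q%:R <= pi :> R by rewrite ler_pdivrMr ?ler_peMr//; lra.
have yq : 2 * pi * `|fracpart y - cell_mid R q i| <= pi / q%:R.
  rewrite ler_pdivlMr; last by lra.
  have : q%:R * `|fracpart y - cell_mid R q i| <= 1 / 2.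
    by rewrite q_cell_mid// ler_norml; lra.
  nra.
apply: cos_le_cos => //; last by lra.
by rewrite !mulr_ge0//; lra.
Qed.

Lemma cos_cell_le (R : realType) (q i : nat) (y : R) :
    (i < q)%N -> cell q y != i ->
  cos (2 * pi * (y - cell_mid R q i)) <= cos (pi / q%:R).
Proof.
move=> iq ci; have q0 : (0 < q)%N by exact: leq_ltn_trans iq.
have q1 : 0 < q%:R :> R by rewrite ltr0n.
have p0 := @pi_gt0 R.
have /andP[f0 f1] := fracpart_itv y.
have i0 : 0 <= i%:R :> R by [].
have iq1 : i%:R + 1 <= q%:R :> R by rewrite natr1 ler_nat.
have qf : q%:R * fracpart y < q%:R by rewrite gtr_pMr.
have qf0 : 0 <= q%:R * fracpart y by rewrite mulr_ge0// ltW.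
rewrite cos_cell; have qE := q_cell_mid i (fracpart y) q0.
set w := `|fracpart y - cell_mid R q i| in qE *.
have qpi : q%:R * (pi / q%:R) = pi :> R by rewrite mulrCA divff ?mulr1// gt_eqF.
have wlo : 1 / 2 <= q%:R * w.
  move: ci; rewrite qE cell_eq -natr1 negb_and -ltNge -leNgt.
  by move=> /orP[ci|ci]; [rewrite ltr0_norm|rewrite ger0_norm]; lra.
(* This bound prevents the point from approaching the midpoint the other way round the circle. *)
have whi : q%:R * w <= q%:R - 1 / 2.
  by rewrite qE ler_norml; lra.
apply: cos_le_cos; first by rewrite divr_ge0// ltW.
- by rewrite -(ler_pM2l q1) qpi; nra.
- by rewrite -(ler_pM2l q1) mulrBr qpi; nra.
Qed.

(* Polynomials in cos(2 pi (x - c)) have a mean independent of c, so the longer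
   arc, wherever it lies, has at least the mean of the shorter one. *)
Lemma mean_cell_le_cell (R : realType) (L : (nat -> R) -> R) (x : nat -> R)
    (q i j : nat) :
    invariant_mean L -> weyl_seq L x -> (i < q)%N ->
  L (fun n => (cell q.+1 (x n) == j)%:R) <= L (fun n => (cell q (x n) == i)%:R).
Proof.
move=> mL xw iq; apply/ler_addgt0Pr => e e0.
have q0 : (0 < q)%N by exact: leq_ltn_trans iq.
have p0 := @pi_gt0 R.
(* The gap between the thresholds for q and q + 1 is where the step polynomial may climb from 0 to
   1. *)
have cosq : cos (pi / q%:R) < cos (pi / q.+1%:R) :> R.
  have pq (r : nat) : (0 < r)%N -> pi / r%:R \in `[0, pi : R].
    move=> r0; rewrite in_itv/= divr_ge0 ?pi_ge0//=.
    by rewrite ler_pdivrMr ?ltr0n// ler_peMr ?pi_ge0// ler1n.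
  by rewrite ltr_cos ?pq// ltr_pM2l// ltf_pV2 ?posrE ?ltr0n// ltr_nat.
have e2 : 0 < e / 2 by lra.
have [P PP] := step_poly (cos_geN1 _) cosq (cos_le1 _) e2.
have Pcos y : 0 <= P.[cos y] <= 1.
  by have [] := PP (cos y); rewrite ?cos_geN1 ?cos_le1.
have [m Pm] := mean_poly_cos P mL xw.
have Pb c : seq_bounded (fun n => P.[cos (2 * pi * (x n - c))]).
  exists 1 => n; have /andP[P0 P1] := Pcos (2 * pi * (x n - c)).
  by rewrite ger0_norm.
have mlo : L (fun n => (cell q.+1 (x n) == j)%:R) <= m + e / 2.
  rewrite -(Pm (cell_mid R q.+1 j)) -[e / 2](mean_cst mL).
  rewrite -(mean_add mL); [|exact: Pb|exact: seq_bounded_cst].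
  apply: (mean_le mL).
  - exact: seq_bounded_bool.
  - by apply: seq_bounded_add; [exact: Pb|exact: seq_bounded_cst].
  move=> n; case: eqP => [<-|_].
    have [] := PP (cos (2 * pi * (x n - cell_mid R q.+1 (cell q.+1 (x n))))).
      by rewrite cos_geN1 cos_le1.
    by move=> _ /(_ (cos_cell_ge _ _)) + _; rewrite -lerBlDr; apply.
  have /andP[P0 _] := Pcos (2 * pi * (x n - cell_mid R q.+1 j)).
  by rewrite addr_ge0 ?(ltW e2).
have mhi : m <= L (fun n => (cell q (x n) == i)%:R) + e / 2.
  rewrite -(Pm (cell_mid R q i)) -[e / 2](mean_cst mL).
  rewrite -(mean_add mL); [|exact: seq_bounded_bool|exact: seq_bounded_cst].
  apply: (mean_le mL).
  - exact: Pb.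
  - by apply: seq_bounded_add; [exact: seq_bounded_bool|exact: seq_bounded_cst].
  move=> n; have [] := PP (cos (2 * pi * (x n - cell_mid R q i))).
    by rewrite cos_geN1 cos_le1.
  case: (eqVneq (cell q (x n)) i) => [_ /andP[_ P1] _ _|ci _ _].
    by rewrite (le_trans P1)// lerDl ltW.
  by rewrite add0r; apply; exact: cos_cell_le.
lra.
Qed.

(* Comparing the arcs of length 1/(q+1) with all q arcs of length 1/q costs
   nothing in the limit and avoids computing the mean of an arc exactly. *)
Lemma mean_cell_le (R : realType) (L : (nat -> R) -> R) (x : nat -> R)
    (q j : nat) :
    invariant_mean L -> weyl_seq L x -> (0 < q)%N ->
  L (fun n => (cell q.+1 (x n) == j)%:R) <= q%:R^-1.
Proof.
move=> mL xw q0; set l := L _.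
have : \sum_(i < q) L (fun n => (cell q (x n) == i)%:R) = 1.
  rewrite -mean_sum//; last by move=> i; exact: seq_bounded_bool.
  rewrite -[RHS](mean_cst mL); congr L; apply/funext => n.
  rewrite (bigD1 (Ordinal (cell_lt (x n) q0)))//= eqxx big1 ?addr0// => i.
  by rewrite -val_eqE /= eq_sym => /negPf ->.
have : \sum_(i < q) l <= \sum_(i < q) L (fun n => (cell q (x n) == i)%:R).
  by apply: ler_sum => i _; exact: mean_cell_le_cell.
move=> + E; rewrite E sumr_const card_ord => lq.
by rewrite -[leRHS]mul1r ler_pdivlMr ?ltr0n// mulr_natr.
Qed.

(** * Sums confined to an arc *)

Definition nsumset (p k : nat) (J : {set 'F_p}) : {set 'F_p} :=
  iter k (sumset J) [set 0]%SET.

(** Each application of Cauchy-Davenport adds |J| - 1 elements, starting from the singleton 0. *)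
Lemma nsumset_card_ge (p k : nat) (J : {set 'F_p}) (j : 'F_p) :
    prime p -> j \in J ->
  (minn p (k * #|J|.-1).+1 <= #|nsumset k J|)%N.
Proof.
move=> p_pr jJ; have p0 := prime_gt0 p_pr.
elim: k => [|k IH]; first by rewrite mul0n cards1 geq_minr.
have /card_gt0P[z zJ] : (0 < #|nsumset k J|)%N.
  by apply: leq_trans IH; rewrite leq_min p0.
apply: leq_trans (cauchy_davenport p_pr jJ zJ).
have J0 : (0 < #|J|)%N by apply/card_gt0P; exists j.
rewrite mulSn; move: #|J| (#|nsumset k J|) IH J0 => c s; clear.
by move: (k * c.-1)%N => t; lia.
Qed.

Lemma nsumsetP (p k : nat) (J : {set 'F_p}) (z : 'F_p) :
  z \in nsumset k J ->
  exists2 s : 'I_k -> 'F_p, (forall i, s i \in J) & z = \sum_(i < k) s i.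
Proof.
elim: k z => [|k IH] z.
  rewrite finset.in_set1 => /eqP ->; exists (fun _ => 0) => [[]//|].
  by rewrite big_ord0.
move=> /imset2P[u v uJ /IH[s sJ ->] ->].
exists (fun i => if unlift ord0 i is Some i' then s i' else u) => [i|].
  by case: unlift.
rewrite big_ord_recl unlift_none; congr (_ + _).
by apply: eq_bigr => i _; rewrite liftK.
Qed.

(** Rounding p times each fractional part down loses at most k in total. The fractional parts sum to
    that of the total plus an integer N, and p N vanishes mod p; adding k makes the representative
    [w] nonnegative. *)
Lemma cell_sum_residue (R : realType) (p k : nat) (l : R) (y : 'I_k -> R) :
    prime p -> fracpart (\sum_i y i) <= l ->
  exists2 w : nat, w%:R <= p%:R * l + k%:R &
    \sum_i (cell p (y i))%:R = w%:R - k%:R :> 'F_p.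
Proof.
move=> p_pr yl; set fr := fracpart _ in yl.
have p0 : 0 < p%:R :> R by rewrite ltr0n prime_gt0.
pose T := (\sum_i cell p (y i))%N.
pose N := Num.floor (\sum_i y i) - \sum_i Num.floor (y i).
have sumE : \sum_i fracpart (y i) = fr + N%:~R.
  rewrite /fracpart sumrB /N intrB (raddf_sum (intr : int -> R)).
  by rewrite /fr /fracpart addrA subrK.
have Tlo : T%:R <= p%:R * (fr + N%:~R).
  rewrite -sumE mulr_sumr natr_sum; apply: ler_sum => i _.
  by have /andP[] := cell_itv p (y i).
have Thi : p%:R * (fr + N%:~R) <= T%:R + k%:R.
  rewrite -sumE mulr_sumr natr_sum.
  rewrite -[in k%:R](card_ord k) -sumr_const -big_split; apply: ler_sum => i _.
  by have /andP[_ /ltW] := cell_itv p (y i); rewrite -natr1.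
have /andP[fr0 _] := fracpart_itv (\sum_i y i).
pose w : int := T%:Z + k%:Z - p%:Z * N.
have wE : w%:~R = T%:R + k%:R - p%:R * N%:~R :> R.
  by rewrite intrB intrM intrD.
have w0 : 0 <= w.
  rewrite -(ler_int R) wE; have := mulr_ge0 (ltW p0) fr0.
  by rewrite -/fr; lra.
exists `|w|%N.
  rewrite -(gez0_abs w0) in wE; rewrite pmulrn wE.
  have := ler_wpM2l (ltW p0) yl; lra.
rewrite -natr_sum -/T [X in _ = X - _]pmulrn gez0_abs//.
rewrite intrB intrM intrD -!pmulrn.
by rewrite (pcharf0 (pchar_Fp p_pr)) mul0r subr0 addrK.
Qed.

(** [A] is covered by |J| arcs of length 1/p, each of mean at most 1/(p - 1) by the comparison with
    q = p - 1. *)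
Lemma density_le_residues (R : realType) (L : (nat -> R) -> R) (x : nat -> R)
    (A : set nat) (p : nat) (J : {set 'F_p}) :
    invariant_mean L -> weyl_seq L x -> prime p ->
    (forall a, A a -> (cell p (x a))%:R \in J) ->
  L (fun n => (n \in A)%:R) * (p%:R - 1) <= #|J|%:R.
Proof.
move=> mL xw p_pr AJ.
have p1 := prime_gt1 p_pr.
have pE : p.-1.+1 = p by rewrite prednK// prime_gt0.
have : L (fun n => (n \in A)%:R) <=
    L (fun n => \sum_(j in J) (cell p (x n) == j)%:R).
  apply: (mean_le mL); first exact: seq_bounded_bool.
    rewrite (_ : (fun n => _) = fun n =>
      \sum_(j <- enum J) (cell p (x n) == j)%:R); last first.
      by apply/funext => n; rewrite big_enum.
    by apply: seq_bounded_sum => j; exact: seq_bounded_bool.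
  move=> n; case: (boolP (n \in A)) => [|_]; last by rewrite sumr_ge0.
  rewrite inE => /AJ nJ; rewrite (bigD1 _ nJ)/= val_Fp_nat//.
  rewrite modn_small ?cell_lt ?prime_gt0// eqxx lerDl.
  by rewrite sumr_ge0.
have -> : L (fun n => \sum_(j in J) (cell p (x n) == j)%:R) =
    \sum_(j in J) L (fun n => (cell p (x n) == j)%:R).
  rewrite -big_enum -mean_sum//; last by move=> j; exact: seq_bounded_bool.
  by congr L; apply/funext => n; rewrite big_enum.
have : \sum_(j in J) L (fun n => (cell p (x n) == j)%:R) <=
    \sum_(j in J) (p.-1)%:R^-1.
  apply: ler_sum => j _; rewrite -{1}pE.
  by apply: mean_cell_le => //; rewrite -ltnS pE.
rewrite sumr_const => h1 /le_trans/(_ h1).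
have -> : p%:R - 1 = p.-1%:R :> R by rewrite -{1}pE -natr1 addrK.
by rewrite -[leRHS]mulr_natl ler_pdivlMr// ltr0n -ltnS pE.
Qed.

(* The Cauchy-Davenport lower bound for the k-fold sumset of the occupied cells
   contradicts the arc of length l as soon as the prime p is large. *)
Lemma mean_le_arc (R : realType) (L : (nat -> R) -> R) (x : nat -> R)
    (A : set nat) (k : nat) (l : R) :
    invariant_mean L -> weyl_seq L x -> 0 <= l < 1 -> (0 < k)%N ->
    (forall a : 'I_k -> nat, (forall i, A (a i)) ->
      fracpart (\sum_i x (a i)) <= l) ->
  k%:R * L (fun n => (n \in A)%:R) <= l.
Proof.
move=> mL xw /andP[l0 l1] k0 Al; set d := L _; rewrite leNgt; apply/negP => dl.
(* Both summands are positive. Exceeding the first gives p l + k + 1 < p, so the minimum in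
   Cauchy-Davenport cannot be p; exceeding the second gives k (d (p - 1) - 1) + 1 > p l + k + 1. *)
pose X := (k%:R + 1) / (1 - l) + (k%:R * d + 2 * k%:R) / (k%:R * d - l).
have [p pX p_pr] := prime_above (Num.truncn X).+1.
have Xp : X < p%:R.
  by rewrite (lt_trans (truncnS_gt X))// ltr_nat.
have k1 : 1 <= k%:R :> R by rewrite ler1n.
have d0 : 0 < d by rewrite -(pmulr_rgt0 _ (lt_le_trans ltr01 k1)); lra.
have Y0 : 0 < (k%:R + 1) / (1 - l) by rewrite divr_gt0//; lra.
have Z0 : 0 < (k%:R * d + 2 * k%:R) / (k%:R * d - l) by rewrite divr_gt0//; nra.
have pY : k%:R + 1 < p%:R * (1 - l).
  by rewrite -ltr_pdivrMr; rewrite /X in Xp; lra.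
have pZ : k%:R * d + 2 * k%:R < p%:R * (k%:R * d - l).
  by rewrite -ltr_pdivrMr; rewrite /X in Xp; lra.
pose J : {set 'F_p} :=
  [set j : 'F_p | `[< exists2 a, A a & j = (cell p (x a))%:R >]]%SET.
have AJ a : A a -> (cell p (x a))%:R \in J.
  by move=> Aa; rewrite inE; apply/asboolP; exists a.
have dJ := density_le_residues mL xw p_pr AJ; rewrite -/d in dJ.
have p1 : 1 < p%:R :> R by rewrite ltr1n prime_gt1.
have J0 : (0 < #|J|)%N.
  by rewrite -(ltr_nat R) (lt_le_trans _ dJ)// mulr_gt0//; lra.
have /card_gt0P[j jJ] := J0.
pose M := (Num.truncn (p%:R * l + k%:R)).+1.
have Mle : M%:R <= p%:R * l + k%:R + 1.
  by rewrite /M -natr1 lerD2r truncn_le addr_ge0// mulr_ge0.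
(* All k-fold sums of occupied cells are of the form w - k with 0 <= w < M. *)
have : (#|nsumset k J| <= M)%N.
  rewrite -[leqRHS]card_ord.
  pose g (w : 'I_M) : 'F_p := w%:R - k%:R.
  apply: leq_trans (leq_imset_card g _).
  apply/subset_leq_card/fintype.subsetP => z /nsumsetP[s sJ ->].
  have /choice[a aP] : forall i, exists a, A a /\ s i = (cell p (x a))%:R.
    by move=> i; have := sJ i; rewrite inE => /asboolP[a Aa sa]; exists a.
  have [w wM wE] := cell_sum_residue p_pr (Al a (fun i => (aP i).1)).
  have wltM : (w < M)%N.
    by rewrite /M ltnS truncn_ge_nat// (le_trans _ wM).
  apply/imsetP; exists (Ordinal wltM) => //.
  by rewrite /g /= -wE; apply: eq_bigr => i _; exact: (aP i).2.
move=> cM; have := leq_trans (nsumset_card_ge k p_pr jJ) cM.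
rewrite geq_min -!(ler_nat R) => /orP[|]; first by lra.
rewrite -natr1 natrM.
have -> : #|J|.-1%:R = #|J|%:R - 1 :> R by rewrite -(prednK J0) -natr1 addrK.
by nra.
Qed.

(** * Upper density, tails of sets, and Beatty numbers *)

Lemma upper_density_gt (R : realType) (A : set nat) (c : R) :
    (c%:E < upper_density R A)%E ->
  exists2 d, c < d & forall n, exists2 N, (n <= N)%N &
    d <= cesaro_mean (fun m : nat => (m \in A)%:R) N.
Proof.
move=> cA.
(* A [d] strictly above [c] keeps the inequality strict after passing to the mean. *)
have [d cd dA] : exists2 d, c < d & (d%:E < upper_density R A)%E.
  move: cA; case: (upper_density R A) => [r| |]//.
    by rewrite lte_fin => cr; exists ((c + r) / 2); rewrite ?lte_fin; lra.
  by move=> _; exists (c + 1); rewrite ?ltry//; lra.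
exists d => // n.
(* The limsup is an infimum of suprema over tails, so it is at most the supremum over this tail. *)
have : (d%:E < ereal_sup [set
    ((#|` fset_set (A `&` [set m : nat | (1 <= m <= N)%N])|%fset)%:R
       / N%:R : R)%:E | N in [set N | (n <= N)%N]])%E.
  apply: lt_le_trans dA _; apply: ereal_inf_lbound.
  by exists [set N | (n <= N)%N] => //; exists n.
move=> /ereal_sup_gt[_ [N /= nN <-]]; rewrite lte_fin => /ltW dN.
exists N => //; apply: le_trans dN _; rewrite le_eqVlt; apply/orP; left.
apply/eqP; rewrite /cesaro_mean; congr (_ / _).
have fin : finite_set (A `&` [set m : nat | (1 <= m <= N)%N]).
  apply: (@sub_finite_set _ _ `I_N.+1); last exact: finite_II.
  by move=> m [_ /= /andP[_]].
rewrite -(big_mkord xpredT (fun i => (i.+1 \in A)%:R : R)) -natr_sum.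
congr (_%:R).
rewrite -[RHS](big_add1 _ _ 0 N.+1 xpredT (fun i => nat_of_bool (i \in A))).
rewrite /index_iota subSS subn0 -[RHS]big_mkcond sum1_count -size_filter.
apply/perm_size/uniq_perm; rewrite ?fset_uniq ?filter_uniq ?iota_uniq// => m.
rewrite mem_filter mem_iota in_fset_set// in_setI add1n ltnS; congr (_ && _).
by apply/idP/idP; rewrite inE.
Qed.

(** After a shift by m + 1 the two indicators coincide. *)
Lemma mean_tail (R : realType) (L : (nat -> R) -> R) (A : set nat) (m : nat) :
    invariant_mean L ->
  L (fun n => (n \in A)%:R) =
  L (fun n => (n \in A `&` [set n | (m < n)%N])%:R).
Proof.
move=> mL; rewrite -(mean_shift m.+1 mL); last exact: seq_bounded_bool.
rewrite -[RHS](mean_shift m.+1 mL); last exact: seq_bounded_bool.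
congr L; apply/funext => n; rewrite in_setI (_ : (_ \in [set _ | _]) = true).
  by rewrite andbT.
by apply: mem_set; rewrite /= addnS ltnS leq_addl.
Qed.

(** Put y = s / alpha and n = floor(y) + 1. If the fractional part of y exceeds 1 - 1 / alpha, then
    0 < n - y < 1 / alpha, so s < n alpha < s + 1 and s is the floor of n alpha. *)
Lemma beatty_fracpart (R : realType) (alpha : R) (s : int) :
    1 < alpha -> 0 <= s -> ~ beatty_set alpha s ->
  fracpart (alpha^-1 * s%:~R) <= 1 - alpha^-1.
Proof.
move=> a1 s0 sB; rewrite leNgt; apply/negP => fa; apply: sB.
have a0 : 0 < alpha by lra.
set y := alpha^-1 * s%:~R in fa; have /andP[_ f1] := fracpart_itv y.
have y0 : 0 <= y by rewrite mulr_ge0 ?ler0z// invr_ge0 ltW.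
have fl0 : 0 <= Num.floor y by rewrite floor_ge0.
exists (`|Num.floor y|.+1)%N => //; apply: floor_def.
have ay : alpha * y = s%:~R by rewrite mulVKf// gt_eqF.
have aV : alpha * alpha^-1 = 1 by rewrite divff// gt_eqF.
rewrite -natr1 pmulrn gez0_abs// intrD -ay.
by rewrite /fracpart in fa f1; apply/andP; split; nra.
Qed.

Lemma horner_nonneg (f : {poly int}) (a : nat) :
  (forall i : nat, f`_i != 0 -> 0 < f`_i) -> 0 <= f.[a%:Z].
Proof.
move=> fp; rewrite horner_coef sumr_ge0// => i _; rewrite mulr_ge0//.
by have [->//|/fp/ltW] := eqVneq f`_i 0.
Qed.

(** The leading term alone suffices: its coefficient is at least 1 and its degree at least 1. *)
Lemma horner_ge_id (f : {poly int}) (a : nat) :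
    (1 < size f)%N -> (forall i : nat, f`_i != 0 -> 0 < f`_i) -> (0 < a)%N ->
  a%:Z <= f.[a%:Z].
Proof.
move=> f1 fp a0; rewrite horner_coef.
have sP : ((size f).-1 < size f)%N by rewrite prednK// ltnW.
rewrite (bigD1 (Ordinal sP))//= -lead_coefE.
have l1 : 1 <= lead_coef f.
  rewrite -gtz0_ge1 lead_coefE; apply: fp.
  by rewrite -lead_coefE lead_coef_eq0 -size_poly_gt0 ltnW.
have aa : a%:Z <= a%:Z ^+ (size f).-1.
  by rewrite ler_eXnr// -ltnS prednK// ltnW.
rewrite -[leLHS]addr0 lerD//.
  by rewrite (le_trans aa)// ler_peMl// exprn_ge0.
rewrite sumr_ge0// => i _; rewrite mulr_ge0//.
by have [->//|/fp/ltW] := eqVneq f`_i 0.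
Qed.

Theorem theorem1 (R : realType) (alpha : R) (k : nat) (f : {poly int})
    (A : set nat)
    (alpha_gt1 : 1 < alpha) (alpha_irrational : irrational alpha)
    (k_ge2 : (2 <= k)%N)
    (f_nonconstant : (1 < size f)%N)
    (f_pos_coefs : forall i : nat, f`_i != 0 -> 0 < f`_i)
    (A_pos : forall a : nat, A a -> (0 < a)%N)
    (A_infinite : infinite_set A)
    (A_density :
      ((1 / k%:R - 1 / (k%:R * alpha))%:E < upper_density R A)%E) :
  infinite_set (poly_sums f k A `&` beatty_set alpha).
Proof.
move=> /finite_seqP[S SE].
have a0 : 0 < alpha by lra.
have k0 : (0 < k)%N by exact: leq_trans k_ge2.
have kR : 0 < k%:R :> R by rewrite ltr0n.
have [d cd freq] := upper_density_gt A_density.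
have [L mL Ld] := exists_invariant_mean R (D := [set N |
  d <= cesaro_mean (fun m : nat => (m \in A)%:R) N]) freq.
have aVi : irrational alpha^-1.
  move=> [q _ qa]; apply: alpha_irrational; exists q^-1 => //.
  by rewrite fmorphV/= qa invrK.
pose x (n : nat) : R := alpha^-1 * (f.[n%:Z])%:~R.
have xw : weyl_seq L x.
  (* The frequency [h] is absorbed into the integer polynomial h f, which has the size of f. *)
  move=> h h0.
  have hf : (1 < size (h *: f))%N by rewrite size_scale.
  have xh (n : nat) : h%:~R * x n = alpha^-1 * (((h *: f).[n%:Z])%:~R).
    by rewrite hornerZ intrM /x mulrCA.
  have [] := weyl_poly mL aVi hf.
  by split; under eq_fun do rewrite xh.
(* [m] bounds every Beatty sum; since f(a) >= a, a sum over elements beyond [m] exceeds it. *)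
pose m := (\max_(s <- S) `|s|)%N.
pose A' := A `&` [set n | (m < n)%N].
have aV01 : 0 < alpha^-1 < 1 by rewrite invr_gt0 a0 invf_lt1.
have : k%:R * L (fun n => (n \in A')%:R) <= 1 - alpha^-1.
  apply: (mean_le_arc mL xw) => //; first by lra.
  move=> a aA; pose s := \sum_(i < k) f.[(a i)%:Z].
  have -> : \sum_(i < k) x (a i) = alpha^-1 * s%:~R.
    by rewrite -mulr_sumr (raddf_sum (intr : int -> R)).
  have ms : m%:Z < s.
    pose i0 := Ordinal k0.
    rewrite /s (bigD1 i0)//= (lt_le_trans (_ : m%:Z < (a i0)%:Z))//.
      by rewrite ltz_nat; exact: (aA i0).2.
    rewrite -[leLHS]addr0 lerD//.
      by apply: horner_ge_id => //; apply: A_pos; exact: (aA i0).1.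
    by rewrite sumr_ge0// => i _; exact: horner_nonneg.
  apply: beatty_fracpart => //; first by rewrite (le_trans _ (ltW ms)).
  move=> sB; have : s \in S.
    suff : [set` S] s by [].
    by rewrite -SE; split=> //; exists a => // i; exact: (aA i).1.
  move=> sS; have : (`|s| <= m)%N by rewrite /m (leq_bigmax_seq _ sS).
  by move: ms; lia.
rewrite -mean_tail//.
have := Ld _ _ (seq_bounded_bool R (fun n => n \in A)) (fun _ dN => dN).
move=> dL kL; have : k%:R * d <= 1 - alpha^-1.
  by rewrite (le_trans _ kL)// ler_pM2l.
(* The density threshold is exactly (1 - 1 / alpha) / k, so [d] above it contradicts the arc
   bound. *)
have kE : k%:R * (1 / k%:R - 1 / (k%:R * alpha)) = 1 - alpha^-1.
  by field; rewrite !gt_eqF.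
by move: cd; rewrite -(ltr_pM2l kR) kE; lra.
Qed.
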